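(* For every integer $n\ge1$ and $m\ge0$, \[ \mathcal{B}_{n,m}^{(k)}(a,q,L)=\sum_{j=1}^{n}q^{n-j}\sum_{i=1}^{n}i!\left\{ {n \atop i} \right\}\left\{ {i-1 \atop j-1} \right\}\mathcal{C}_{j,m}^{(k)}(a,q,L). \]
   Context: Let $k\ge1$ be an integer, $a,q,l_1,\dots,l_k$ nonzero reals, $l=\prod l_i$, $L=(l_1,\dots,l_k)$; denominators $a+j$ ($j\ge0$ integer) assumed nonzero and $l^{a+i}$ means $l^al^i$. Let $s(n,i)$ be the signed Stirling numbers of the first kind ($\frac{1}{i!}(\ln(1+x))^i=\sum_{n\ge i}s(n,i)\frac{x^n}{n!}$) and $\left\{ {n \atop i} \right\}$ the Stirling numbers of the second kind. Define \[ \mathcal{C}_{n,m}^{(k)}(a,q,L)=\frac{(a+m)^k}{a^k}\sum_{i=0}^{n}s(n,i)\frac{q^{n-i}l^{a+i}}{(a+i+m)^k},\qquad \mathcal{B}_{n,m}^{(k)}(a,q,L)=\frac{(a+m)^k}{a^k}\sum_{i=0}^{n}\frac{i!(-q)^{n-i}l^{i+a}}{(a+m+i)^k}\left\{ {n \atop i} \right\}. \] *)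

(* Defs.v *)
From mathcomp Require Import all_boot all_order all_algebra.
From mathcomp Require Import complex.
From mathcomp Require Import reals.
From mathcomp.analysis Require Import sequences exp trigo.
Set Implicit Arguments.
Unset Strict Implicit.
Unset Printing Implicit Defensive.
Import Order.TTheory GRing.Theory Num.Theory.
Local Open Scope ring_scope.
Local Open Scope complex_scope.

(* The formal series ln(1 + x), truncated after degree n. *)
Definition log1p_poly (R : realType) (n : nat) : {poly R} :=
  \sum_(1 <= r < n.+1) ((-1) ^+ r.-1 / r%:R) *: 'X^r.

(* n! times the coefficient of x^n in (ln(1 + x))^i / i!; the series may be
   truncated because ln(1 + x) has no constant term, so that terms of degree
   larger than n do not contribute to the coefficient of x^n. *)
Definition stirling1 (R : realType) (n i : nat) : R :=
  n`!%:R * ((i`!%:R)^-1 *: log1p_poly R n ^+ i)`_n.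

Fixpoint stirling2 (n i : nat) : nat :=
  match n, i with
  | 0, 0 => 1
  | 0, _.+1 => 0
  | _.+1, 0 => 0
  | n'.+1, i'.+1 => i'.+1 * stirling2 n' i'.+1 + stirling2 n' i'
  end%N.

(* x ^ a for a nonzero real base of either sign and a real exponent, as a
   complex number: the principal value exp(a (ln|x| + i arg x)), where
   arg x = pi if x < 0 and arg x = 0 if x > 0. *)
Definition arg_real (R : realType) (x : R) : R := if x < 0 then pi else 0.

Definition cpowR (R : realType) (x a : R) : R[i] :=
  (expR (a * ln `|x|))%:C * (cos (a * arg_real x) +i* sin (a * arg_real x)).

Lemma cpowR_gt0 (R : realType) (x a : R) :
  0 < x -> cpowR x a = (x `^ a)%:C.
Proof.
move=> x0; rewrite /cpowR /arg_real ltNge ltW//= mulr0 cos0 sin0 gtr0_norm//.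
by rewrite /powR gt_eqF// mulr1.
Qed.

Lemma cpowR_nat (R : realType) (x : R) (n : nat) :
  x != 0 -> cpowR x n%:R = (x ^+ n)%:C.
Proof.
move=> x0; rewrite /cpowR.
have -> : expR (n%:R * ln `|x|) = `|x| ^+ n.
  by rewrite -powR_mulrn// /powR normr_eq0 (negbTE x0).
rewrite /arg_real; case: (ltP x 0) => [xn|xp]; last first.
  by rewrite mulr0 cos0 sin0 mulr1 ger0_norm.
have [-> ->] : cos (n%:R * pi : R) = (-1) ^+ n /\ sin (n%:R * pi : R) = 0.
  elim: n => [|n [IHc IHs]]; first by rewrite mul0r cos0 sin0.
  rewrite -natr1 mulrDl mul1r cosDpi sinDpi IHc IHs oppr0; split => //.
  by rewrite exprSr mulrN1.
rewrite -[_ +i* 0]/(_%:C) -rmorphM/=; congr (_%:C).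
by rewrite ltr0_norm// -exprMn mulrN1 opprK.
Qed.

(* l ^ (a + i), understood as l ^ a * l ^ i. *)
Definition lpow (R : realType) (l a : R) (i : nat) : R[i] :=
  cpowR l a * (l ^+ i)%:C.

Definition poly_cauchy (R : realType) (k : nat) (a q : R) (L : 'I_k -> R)
    (n m : nat) : R[i] :=
  let l := \prod_(p < k) L p in
  ((a + m%:R) ^+ k / a ^+ k)%:C *
  \sum_(0 <= i < n.+1)
    (stirling1 R n i)%:C *
    ((q ^+ (n - i))%:C * lpow l a i / ((a + i%:R + m%:R) ^+ k)%:C).

Definition poly_bernoulli (R : realType) (k : nat) (a q : R) (L : 'I_k -> R)
    (n m : nat) : R[i] :=
  let l := \prod_(p < k) L p in
  ((a + m%:R) ^+ k / a ^+ k)%:C *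
  \sum_(0 <= i < n.+1)
    (i`!%:R * ((- q) ^+ (n - i))%:C * lpow l a i
       / ((a + m%:R + i%:R) ^+ k)%:C) * (stirling2 n i)%:R.

(* Main.v *)
Require Import Defs.
From mathcomp Require Import all_boot all_order all_algebra.
From mathcomp Require Import complex.
From mathcomp Require Import reals.
From mathcomp.analysis Require Import sequences exp trigo.
From mathcomp Require Import ring zify.
Import Order.TTheory GRing.Theory Num.Theory.
Local Open Scope ring_scope.
Local Open Scope complex_scope.

(** Comparing the coefficients of [l^(a+t) / (a+m+t)^k], the theorem reduces to
    [(-1)^n P(-x) = \sum_i i! S(n,i) x (x-1)^(i-1)] with
    [P(x) = \sum_t t! S(n,t) x^t], because
    [\sum_j S(i-1,j-1) x(x-1)...(x-j+1) = x (x-1)^(i-1)].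
    After multiplication by [x - 1] this is the reflection formula
    [F_n(x-1) = (-1)^(n+1) F_n(-x)] for [F_n = (1+x) P_n], which follows by
    induction from [F_(n+1) = x (1+x) F_n']. *)

Lemma stirling2_gt (n i : nat) : (n < i)%N -> stirling2 n i = 0%N.
Proof.
elim: n i => [|n IH] [|i]//= ni.
by rewrite !IH ?muln0// ltnW.
Qed.

(** Without a constant term, [f] is divisible by ['X], hence [f ^+ i] by ['X^i]. *)
Lemma coef_exp_gt (R : comNzRingType) (f : {poly R}) (n i : nat) :
  f`_0 = 0 -> (n < i)%N -> (f ^+ i)`_n = 0.
Proof.
move=> f0; elim: i n => [|i IH] n// ni.
rewrite exprS coefM big1// => -[[|r] rn] _ /=; first by rewrite f0 mul0r.
by rewrite IH ?mulr0//; lia.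
Qed.

Lemma eq_coef_exp (R : comNzRingType) (f g : {poly R}) (n i : nat) :
  (forall r, (r <= n)%N -> f`_r = g`_r) ->
  forall r, (r <= n)%N -> (f ^+ i)`_r = (g ^+ i)`_r.
Proof.
move=> fg; elim: i => [|i IH] r rn; first by rewrite !expr0.
rewrite !exprS !coefM; apply: eq_bigr => -[s sr] _ /=.
by rewrite fg ?IH//; lia.
Qed.

Lemma coef_comp_polyNX (R : comNzRingType) (p : {poly R}) (t : nat) :
  (p \Po (- 'X))`_t = (-1) ^+ t * p`_t.
Proof.
elim/poly_ind: p t => [|p c IH] t; first by rewrite comp_poly0 coef0 mulr0.
rewrite comp_polyD comp_polyM comp_polyX comp_polyC mulrN !coefD coefN !coefMX.
rewrite !coefC; case: t => [|t] /=; first by rewrite oppr0 mul1r.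
by rewrite IH !addr0 exprS mulN1r mulNr.
Qed.

Section Stirling1.
Variable R : realType.

Lemma coef_log1p_poly (n r : nat) :
  (log1p_poly R n)`_r =
  if (0 < r <= n)%N then (-1) ^+ r.-1 / r%:R else 0.
Proof.
rewrite /log1p_poly coef_sum.
under eq_bigr do rewrite coefZ coefXn.
case: ifP => rn; last first.
  rewrite big_nat big1// => i /andP[i1 i2].
  case: eqP => [ri|_]; last by rewrite mulr0.
  by move: rn; rewrite ri; lia.
rewrite (bigD1_seq r) ?mem_index_iota ?iota_uniq//= eqxx mulr1 big1 ?addr0//.
by move=> i /negbTE; rewrite eq_sym => ->; rewrite mulr0.
Qed.

(** The derivative is the geometric sum of (-x)^r over r < n, which telescopes against 1 + x. *)
Lemma deriv_log1p_poly (n : nat) :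
  (1 + 'X) * (log1p_poly R n)^`() = 1 - (- 1) ^+ n *: 'X^n.
Proof.
elim: n => [|n IH].
  by rewrite /log1p_poly big_geq// linear0 mulr0 expr0 scale1r subrr.
have -> : log1p_poly R n.+1 =
    log1p_poly R n + ((-1) ^+ n / n.+1%:R) *: 'X^(n.+1).
  by rewrite /log1p_poly big_nat_recr.
rewrite derivD mulrDr IH derivZ derivXn/= -scaler_nat scalerA divfK ?pnatr_eq0//.
rewrite !exprS -!mul_polyC !rmorphM/= polyCN.
by ring.
Qed.

(** [stirling1] truncates the logarithm at a degree that depends on n; a recurrence in n has to
    compare different truncations. *)
Lemma coef_log1p_poly_exp_widen (n N i : nat) : (n <= N)%N ->
  (log1p_poly R N ^+ i)`_n = (log1p_poly R n ^+ i)`_n.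
Proof.
move=> nN; apply: (@eq_coef_exp _ _ _ n) => // r rn; rewrite !coef_log1p_poly rn.
by rewrite (leq_trans rn nN).
Qed.

Lemma stirling1_0S (i : nat) : stirling1 R 0 i.+1 = 0.
Proof. by rewrite /stirling1 /log1p_poly big_geq// expr0n scaler0 coef0 mulr0. Qed.

Lemma stirling1_n0 (n : nat) : stirling1 R n 0 = (n == 0%N)%:R.
Proof.
rewrite /stirling1 expr0 fact0 invr1 scale1r coef1.
by case: n => [|n]; rewrite ?mulr0 ?mulr1.
Qed.

Lemma stirling1_gt (n i : nat) : (n < i)%N -> stirling1 R n i = 0.
Proof.
move=> ni; rewrite /stirling1 coefZ coef_exp_gt ?mulr0//.
by rewrite coef_log1p_poly.
Qed.

(* Coefficient of [x^n] in [(1+x) (f^(i+1))' = (i+1) f^i], [f = ln(1+x)]. *)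
Lemma coef_log1p_poly_exp_rec (n i : nat) :
  (log1p_poly R n.+1 ^+ i.+1)`_n.+1 *+ n.+1 +
  (log1p_poly R n ^+ i.+1)`_n *+ n = (log1p_poly R n ^+ i)`_n *+ i.+1.
Proof.
set f := log1p_poly R n.+1.
(* Since [f] is truncated at n+1, the error term is a multiple of ['X^(n.+1)] and disappears from
   the coefficient of x^n. *)
have H : (1 + 'X) * (f ^+ i.+1)^`() =
    (f ^+ i - (-1) ^+ n.+1 *: (f ^+ i * 'X^(n.+1))) *+ i.+1.
  rewrite deriv_exp/= mulrnAr; congr (_ *+ _).
  rewrite mulrA mulrC.
  by rewrite deriv_log1p_poly mulrBr mulr1 -scalerAr.
have := congr1 (fun p : {poly R} => p`_n) H.
rewrite mulrDl mul1r coefD coefXM coefMn coefB coefZ coefMXn ltnSn mulr0 subr0.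
rewrite coef_deriv.
rewrite -(@coef_log1p_poly_exp_widen n n.+1 i)// -/f => <-; congr (_ + _).
rewrite -(@coef_log1p_poly_exp_widen n n.+1 i.+1)// -/f.
by case: (n) => [|n'] /=; rewrite ?mulr0n// coef_deriv.
Qed.

(** The preceding identity multiplied by n!/(i+1)!. *)
Lemma stirling1_rec (n i : nat) :
  stirling1 R n.+1 i.+1 = stirling1 R n i - n%:R * stirling1 R n i.+1.
Proof.
rewrite /stirling1 !coefZ.
have := coef_log1p_poly_exp_rec n i.
set u := (log1p_poly R n.+1 ^+ i.+1)`_n.+1; set v := (log1p_poly R n ^+ i.+1)`_n.
set w := (log1p_poly R n ^+ i)`_n; rewrite -(mulr_natr u) -(mulr_natr v) -(mulr_natr w) => H.
have f0 : i`!%:R != 0 :> R by rewrite pnatr_eq0 -lt0n fact_gt0.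
have i0 : i.+1%:R != 0 :> R by rewrite pnatr_eq0.
rewrite !factS !natrM.
have -> : w = (u * n.+1%:R + v * n%:R) / i.+1%:R by rewrite H mulfK.
by field; rewrite f0 nat1r i0.
Qed.

(** The falling factorial x(x-1)...(x-n+1), as [stirling1_polyS] shows. *)
Definition stirling1_poly (n : nat) : {poly R} :=
  \poly_(t < n.+1) stirling1 R n t.

Lemma coef_stirling1_poly (n t : nat) : (stirling1_poly n)`_t = stirling1 R n t.
Proof. by rewrite coef_poly; case: ltnP => // /stirling1_gt ->. Qed.

Lemma stirling1_polyS (n : nat) :
  stirling1_poly n.+1 = ('X - n%:R%:P) * stirling1_poly n.
Proof.
apply/polyP => t; rewrite mulrBl coefB coefXM coefCM !coef_stirling1_poly.
case: t => [|t] /=; rewrite ?coef_stirling1_poly ?stirling1_rec// !stirling1_n0.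
by case: n => [|n]; rewrite ?mulr0 ?mul0r subrr.
Qed.

Lemma stirling1_poly1 : stirling1_poly 1 = 'X.
Proof.
rewrite stirling1_polyS subr0.
suff -> : stirling1_poly 0 = 1 by rewrite mulr1.
apply/polyP => -[|t]; rewrite coef_stirling1_poly coef1 ?stirling1_0S//.
by rewrite stirling1_n0.
Qed.

(** This is x times the expansion of (x-1)^i in falling factorials of x-1. With (x)_j the falling
    factorial, the induction uses (x-1) (x)_(j+1) = (x)_(j+2) + j (x)_(j+1). *)
Lemma sum_stirling2_stirling1_poly (n i : nat) : (i < n)%N ->
  \sum_(j < n) (stirling2 i j)%:R *: stirling1_poly j.+1 = 'X * ('X - 1) ^+ i.
Proof.
elim: i n => [|i IH] [|n]// lin.
  rewrite big_ord_recl /= scale1r stirling1_poly1 big1 ?addr0 ?mulr1//.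
  by move=> j _; rewrite /= scale0r.
rewrite big_ord_recl/= scale0r add0r.
under eq_bigr do rewrite /bump/= add1n natrD scalerDl.
rewrite big_split/=.
pose G j := (stirling2 i j)%:R *: stirling1_poly j.+1.
(* The index shift adds a zero term at j = 0; the top term j = n then vanishes because i < n, so
   both sums run over j < n. *)
rewrite (_ : \sum_(j < n) _ *: _ = \sum_(j < n.+1) j%:R *: G j); last first.
  rewrite big_ord_recl/= scale0r add0r; apply: eq_bigr => j _.
  by rewrite /G /bump/= add1n natrM scalerA.
rewrite big_ord_recr/= {2}/G stirling2_gt// scale0r scaler0 addr0 -big_split/=.
rewrite exprSr mulrA -(IH n)// mulr_suml; apply: eq_bigr => j _.
rewrite /G [stirling1_poly j.+2]stirling1_polyS -!mul_polyC -natr1 rmorphD/=.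
ring.
Qed.

End Stirling1.

Section Fubini.
Variable R : idomainType.

(** The polynomial P_n; its coefficients count ordered set partitions by number of blocks. The ring
    is an integral domain so that x - 1 can be cancelled later. *)
Definition fubini_poly (n : nat) : {poly R} :=
  \poly_(t < n.+1) (t`! * stirling2 n t)%:R.

Lemma coef_fubini_poly (n t : nat) :
  (fubini_poly n)`_t = (t`! * stirling2 n t)%:R.
Proof. by rewrite coef_poly; case: ltnP => // /stirling2_gt ->; rewrite muln0. Qed.

Lemma fubini_polyS (n : nat) :
  fubini_poly n.+1 = 'X * ((1 + 'X) * fubini_poly n)^`().
Proof.
apply/polyP => -[|t]; rewrite coefXM coef_fubini_poly//= coef_deriv.
rewrite mulrDl mul1r coefD coefXM/= !coef_fubini_poly -natrD -mulrnA.
by congr (_%:R); rewrite factS; lia.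
Qed.

Lemma fubini_poly1 : fubini_poly 1 = 'X.
Proof.
by apply/polyP => -[|[|t]]; rewrite coef_fubini_poly coefX// stirling2_gt// muln0.
Qed.

(** The factor x(1+x) takes the same value x(x-1) at x-1 and at -x, while the chain rule contributes
    one sign per derivative. The induction starts at index 1, since F_0 = 1 + x does not satisfy the
    formula. *)
Lemma fubini_poly_reflection (n : nat) :
  ((1 + 'X) * fubini_poly n.+1) \Po ('X - 1) =
  (-1) ^+ n *: (((1 + 'X) * fubini_poly n.+1) \Po (- 'X)).
Proof.
elim: n => [|n IH].
  rewrite fubini_poly1 scale1r !comp_polyM !comp_polyD !comp_polyX.
  by rewrite -polyC1 !comp_polyC; ring.
set F := (1 + 'X) * fubini_poly n.+1 in IH *.
have := congr1 (@deriv R) IH.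
rewrite derivZ !deriv_comp derivB derivN derivX -polyC1 derivC subr0 mulr1.
rewrite mulrN1 polyC1 => H.
rewrite fubini_polyS -/F !comp_polyM H !comp_polyD !comp_polyX.
rewrite -polyC1 !comp_polyC -!mul_polyC exprS rmorphM rmorphN/= polyC1.
by ring.
Qed.

Lemma fubini_poly_shift (n : nat) :
  \sum_(i < n.+1) (i.+1`! * stirling2 n.+1 i.+1)%:R *: ('X * ('X - 1) ^+ i) =
  (-1) ^+ n.+1 *: (fubini_poly n.+1 \Po (- 'X)) :> {poly R}.
Proof.
have X1 : 'X - 1 != 0 :> {poly R} by rewrite -polyC1 polyXsubC_eq0.
apply: (mulIf X1); have := fubini_poly_reflection n.
rewrite !comp_polyM !comp_polyD !comp_polyX -polyC1 !comp_polyC polyC1.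
rewrite [1 + _]addrC subrK.
(* The constant term is zero because S(n+1,0) = 0, so the sum starts at index 1 and matches the left
   side of the goal. *)
rewrite {1}/fubini_poly poly_def linear_sum/= big_ord_recl/= scale0r comp_poly0.
rewrite add0r => H.
have -> : (-1) ^+ n.+1 *: (fubini_poly n.+1 \Po (- 'X)) * ('X - 1) =
  (-1) ^+ n *: ((1 - 'X) * (fubini_poly n.+1 \Po (- 'X))).
  by rewrite -!mul_polyC exprS rmorphM rmorphN/= polyC1; ring.
rewrite -H mulr_suml mulr_sumr; apply: eq_bigr => i _.
rewrite comp_polyZ comp_Xn_poly /bump/= add1n exprSr -!mul_polyC.
by ring.
Qed.

End Fubini.

(** The coefficient of x^t in [fubini_poly_shift], with each x(x-1)^i expanded in falling
    factorials. *)
Lemma stirling2_signed_expansion (R : realType) (n t : nat) : (t <= n.+1)%N ->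
  (t`! * stirling2 n.+1 t)%:R * (-1) ^+ (n.+1 - t) =
  \sum_(j < n.+1) \sum_(i < n.+1) (i.+1`! * stirling2 n.+1 i.+1)%:R *
     (stirling2 i j)%:R * stirling1 R j.+1 t.
Proof.
move=> tn; have := congr1 (fun p : {poly R} => p`_t) (fubini_poly_shift R n).
rewrite coefZ coef_comp_polyNX coef_fubini_poly coef_sum mulrA -exprD.
have -> : (-1) ^+ (n.+1 + t) = (-1) ^+ (n.+1 - t) :> R.
  by rewrite -signr_odd -[RHS]signr_odd oddB// oddD.
rewrite mulrC => <-; rewrite exchange_big/=; apply: eq_bigr => i _.
rewrite coefZ -(@sum_stirling2_stirling1_poly R n.+1 i (ltn_ord i)) coef_sum.
rewrite mulr_sumr; apply: eq_bigr => j _.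
by rewrite coefZ coef_stirling1_poly mulrA.
Qed.

Theorem theorem9 (R : realType) (k : nat) (a q : R) (L : 'I_k -> R)
    (hk : (1 <= k)%N) (ha : a != 0) (hq : q != 0)
    (hL : forall p : 'I_k, L p != 0)
    (haj : forall j : nat, a + j%:R != 0)
    (n m : nat) (hn : (1 <= n)%N) :
  poly_bernoulli a q L n m =
  \sum_(1 <= j < n.+1) (q ^+ (n - j))%:C *
    \sum_(1 <= i < n.+1)
      i`!%:R * (stirling2 n i)%:R * (stirling2 i.-1 j.-1)%:R
        * poly_cauchy a q L j m.
Proof.
case: n hn => // n _.
rewrite /poly_bernoulli /poly_cauchy; set l := \prod_(p < k) L p.
set c := (_ / _)%:C.
pose W t := lpow l a t / ((a + m%:R + t%:R) ^+ k)%:C.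
pose A i := (i.+1`! * stirling2 n.+1 i.+1)%:R : R.
(* The powers of q combine to q^(n+1-t), independent of j, and s(j+1,t) = 0 for t > j+1 lets t range
   up to n+1 for every j. *)
have cauchyE (j : nat) : (j < n.+1)%N ->
    (q ^+ (n.+1 - j.+1))%:C * \sum_(0 <= t < j.+2) (stirling1 R j.+1 t)%:C *
      ((q ^+ (j.+1 - t))%:C * lpow l a t / ((a + t%:R + m%:R) ^+ k)%:C) =
    \sum_(t < n.+2) (stirling1 R j.+1 t * q ^+ (n.+1 - t))%:C * W t.
  move=> jn; rewrite mulr_sumr big_mkord.
  rewrite (big_ord_widen n.+2 (fun t => (q ^+ (n.+1 - j.+1))%:C *
    ((stirling1 R j.+1 t)%:C * ((q ^+ (j.+1 - t))%:C * lpow l a t /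
      ((a + t%:R + m%:R) ^+ k)%:C))))//.
  rewrite big_mkcond/=; apply: eq_bigr => t _; case: ltnP => tj; last first.
    by rewrite stirling1_gt// mul0r mul0r.
  rewrite /W [a + t%:R + _]addrAC (_ : n.+1 - t = (n.+1 - j.+1) + (j.+1 - t))%N;
    last by lia.
  by rewrite exprD !rmorphM/=; ring.
transitivity (\sum_(j < n.+1) \sum_(i < n.+1) (A i * (stirling2 i j)%:R)%:C *
    (c * \sum_(t < n.+2) (stirling1 R j.+1 t * q ^+ (n.+1 - t))%:C * W t)).
  under [RHS]eq_bigr => j _ do rewrite -mulr_suml mulrCA mulr_sumr.
  rewrite -mulr_sumr exchange_big/= big_mkord; congr (_ * _).
  apply: eq_bigr => t _.
  (* Splitting off the sign of -q leaves the real coefficient that [stirling2_signed_expansion]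
     expands. *)
  have -> : (t`!%:R * ((- q) ^+ (n.+1 - t))%:C * lpow l a t
      / ((a + m%:R + t%:R) ^+ k)%:C) * (stirling2 n.+1 t)%:R =
    ((t`! * stirling2 n.+1 t)%:R * (-1) ^+ (n.+1 - t))%:C *
    ((q ^+ (n.+1 - t))%:C * W t).
    by rewrite /W (exprNn q) natrM !rmorphM/= !rmorph_nat; ring.
  rewrite stirling2_signed_expansion; last by rewrite -ltnS.
  rewrite rmorph_sum mulr_suml; apply: eq_bigr => j _ /=.
  rewrite !rmorph_sum !mulr_suml; apply: eq_bigr => i _ /=.
  by rewrite /A !rmorphM/=; ring.
rewrite big_add1 big_mkord; apply: eq_bigr => j _ /=.
rewrite big_add1 big_mkord [RHS]mulr_sumr; apply: eq_bigr => i _ /=.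
rewrite -cauchyE// /A natrM !rmorphM/= !rmorph_nat.
by ring.
Qed.
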